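(* Let $\mathcal{X}=\{0,1,2\}$ and let $\mathcal{P}$ be the set of all probability distributions on $\mathcal{X}$. Let $\mathcal{P}_0=\{P_0\}$ consist of the single distribution $P_0=[0.45,\,0.25,\,0.3]$ (i.e. $P_0(0)=0.45$, $P_0(1)=0.25$, $P_0(2)=0.3$), and let $$\mathcal{P}_1=\{P\in\mathcal{P}: E_P[X]\ge 0.9\},$$ where $E_P[X]=\sum_{x\in\mathcal{X}}x\,P(x)$. Then the pair $(\mathcal{P}_0,\mathcal{P}_1)$ does not satisfy the Joint Stochastic Boundedness (JSB) condition; that is, there exist no $Q_0\in\mathcal{P}_0$ and $Q_1\in\mathcal{P}_1$ such that $(\mathcal{P}_0,\mathcal{P}_1)$ is jointly stochastically bounded by $(Q_0,Q_1)$.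
   Context: Joint Stochastic Boundedness: a pair of classes of distributions $(\mathcal{P}_0,\mathcal{P}_1)$ on $\mathcal{X}$ is jointly stochastically bounded by $(Q_0,Q_1)$, where $Q_0\in\mathcal{P}_0$ and $Q_1\in\mathcal{P}_1$, if for all $P_0\in\mathcal{P}_0$, all $P_1\in\mathcal{P}_1$ and all $t\in\mathbb{R}$, $$P_0\{\ln L_q(x)>t\}\le Q_0\{\ln L_q(x)>t\}\quad\text{and}\quad P_1\{\ln L_q(x)>t\}\ge Q_1\{\ln L_q(x)>t\},$$ where $L_q(x)=q_1(x)/q_0(x)$ is the likelihood ratio between $Q_1$ and $Q_0$ ($q_0,q_1$ being the probability mass functions of $Q_0,Q_1$), with the convention $\ln 0=-\infty$. The pair $(\mathcal{P}_0,\mathcal{P}_1)$ satisfies the JSB condition if it is jointly stochastically bounded by some such $(Q_0,Q_1)$. *)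

(* Defs.v *)
From mathcomp Require Import all_boot all_order all_algebra.
From mathcomp Require Import lra.
From mathcomp Require Import classical_sets reals constructive_ereal exp.

Set Implicit Arguments.
Unset Strict Implicit.
Unset Printing Implicit Defensive.
Import Order.TTheory GRing.Theory Num.Theory.
Local Open Scope classical_set_scope.
Local Open Scope ring_scope.

Record dist (R : realType) (X : finType) := Dist {
  pmf :> {ffun X -> R};
  _ : [forall x, 0 <= pmf x] && (\sum_x pmf x == 1)
}.

Definition Pr (R : realType) (X : finType) (P : dist R X) (A : pred X) : R :=
  \sum_(x | A x) P x.

Definition expectation (R : realType) (X : finType) (P : dist R X)
    (f : X -> R) : R :=
  \sum_x f x * P x.

(* The quotient is taken in the extended reals, where a / 0 = +oo for a > 0 and
   0 / 0 = 0; the latter only concerns points that are null for both Q0 and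
   Q1. *)
Definition likelihood_ratio (R : realType) (X : finType) (Q0 Q1 : dist R X)
    (x : X) : \bar R :=
  ((Q1 x)%:E / (Q0 x)%:E)%E.

(* [lne] satisfies ln 0 = -oo and ln +oo = +oo. *)
Definition log_likelihood_ratio (R : realType) (X : finType)
    (Q0 Q1 : dist R X) (x : X) : \bar R :=
  lne (likelihood_ratio Q0 Q1 x).

Definition jointly_stochastically_bounded (R : realType) (X : finType)
    (C0 C1 : set (dist R X)) (Q0 Q1 : dist R X) : Prop :=
  [/\ C0 Q0, C1 Q1 &
    forall P0 P1 : dist R X, C0 P0 -> C1 P1 -> forall t : R,
      Pr P0 (fun x => t%:E < log_likelihood_ratio Q0 Q1 x)%E
        <= Pr Q0 (fun x => t%:E < log_likelihood_ratio Q0 Q1 x)%E /\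
      Pr P1 (fun x => t%:E < log_likelihood_ratio Q0 Q1 x)%E
        >= Pr Q1 (fun x => t%:E < log_likelihood_ratio Q0 Q1 x)%E].

Definition JSB (R : realType) (X : finType) (C0 C1 : set (dist R X)) : Prop :=
  exists Q0 Q1 : dist R X, jointly_stochastically_bounded C0 C1 Q0 Q1.

Definition pmf_P0 (R : realType) : {ffun 'I_3 -> R} :=
  [ffun x : 'I_3 => [:: 45 / 100; 25 / 100; 30 / 100]`_x].

Fact pmf_P0_subproof (R : realType) :
  [forall x, 0 <= pmf_P0 R x] && (\sum_x pmf_P0 R x == 1).
Proof.
apply/andP; split.
  by apply/forallP => -[[|[|[|//]]] ?]; rewrite ffunE /=; lra.
by rewrite !big_ord_recl big_ord0 !ffunE /=; apply/eqP; lra.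
Qed.

Definition dist_P0 (R : realType) : dist R 'I_3 := Dist (pmf_P0_subproof R).

(* Main.v *)
(** Here [Q0] must be [P0], so write [L x = Q1 x / P0 x].  By joint boundedness
    [Q1] minimises [P A] over the second class for every superlevel set [A] of
    [L] at a positive level.  The point masses at [1] and at [2] belong to that
    class, and [L > 0] on a superlevel set, so a nonempty one contains both [1]
    and [2]; hence [L 0 <= L 1 = L 2 =: l].  If [L 0 < l], then [{1, 2}] is a
    superlevel set, and comparing with [[0.55, 0, 0.45]] gives [0.55 l <= 0.45],
    whereas the mean constraint reads [0.85 l >= 0.9].  If [L 0 = l], then
    [Q1 = P0], whose mean is only [0.85]. *)
Require Import Defs.
From mathcomp Require Import all_boot all_order all_algebra.
From mathcomp Require Import lra.
From mathcomp Require Import classical_sets reals constructive_ereal exp.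
Set Implicit Arguments.
Unset Strict Implicit.
Unset Printing Implicit Defensive.
Import Order.TTheory GRing.Theory Num.Theory.
Local Open Scope classical_set_scope.
Local Open Scope ring_scope.

Local Notation o0 := (@Ordinal 3 0 isT).
Local Notation o1 := (@Ordinal 3 1 isT).
Local Notation o2 := (@Ordinal 3 2 isT).

Lemma big_ord3 (V : nmodType) (F : 'I_3 -> V) :
  \sum_i F i = F o0 + F o1 + F o2.
Proof.
rewrite !big_ord_recl big_ord0 addr0 addrA.
by congr (F _ + F _ + F _); apply/val_inj.
Qed.

Lemma pmf_ge0 (R : realType) (X : finType) (P : dist R X) (x : X) : 0 <= P x.
Proof. by case: P => p /= /andP[/forallP]. Qed.

Lemma sum_pmf (R : realType) (X : finType) (P : dist R X) : \sum_x P x = 1.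
Proof. by case: P => p /= /andP[_ /eqP]. Qed.

Lemma exists_dist3 (R : realType) (a b c : R) :
    0 <= a -> 0 <= b -> 0 <= c -> a + b + c = 1 ->
  exists P : dist R 'I_3, [/\ P o0 = a, P o1 = b & P o2 = c].
Proof.
move=> a0 b0 c0 abc; pose p := [ffun x : 'I_3 => [:: a; b; c]`_x].
have pP : [forall x, 0 <= p x] && (\sum_x p x == 1).
  rewrite big_ord3 !ffunE /= abc eqxx andbT.
  by apply/forallP => -[[|[|[|//]]] ?]; rewrite ffunE.
by exists (Dist pP); rewrite /= !ffunE.
Qed.

(** [ln] is increasing on positive reals; at ratio 0 the logarithm is -oo and, [s] being positive,
    both sides are false. *)
Lemma lt_log_likelihood_ratio (R : realType) (X : finType)
    (Q0 Q1 : dist R X) (s : R) (x : X) :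
    0 < s -> 0 < Q0 x ->
  ((ln s)%:E < log_likelihood_ratio Q0 Q1 x)%E = (s < Q1 x / Q0 x).
Proof.
move=> s0 q0; rewrite /log_likelihood_ratio /likelihood_ratio.
rewrite inver (gt_eqF q0) -EFinM /=.
have : 0 <= Q1 x / Q0 x by rewrite divr_ge0 ?pmf_ge0.
rewrite le_eqVlt => /predU1P[<-|L0].
  by rewrite lexx ltNge leNye ltNge (ltW s0).
by rewrite leNgt L0 lte_fin ltr_ln.
Qed.

(** The level [ln s] removes the logarithm, and positivity of [Q0] keeps the ratio finite. *)
Lemma jsb_superlevel (R : realType) (X : finType) (C0 C1 : set (dist R X))
    (Q0 Q1 P : dist R X) (s : R) :
    jointly_stochastically_bounded C0 C1 Q0 Q1 ->
    (forall x, 0 < Q0 x) -> C1 P -> 0 < s ->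
  \sum_(x | s < Q1 x / Q0 x) Q1 x <= \sum_(x | s < Q1 x / Q0 x) P x.
Proof.
move=> [CQ0 _ jsb] Q0_gt0 CP s0; have [_] := jsb Q0 P CQ0 CP (ln s).
rewrite /Pr; under eq_bigl do rewrite lt_log_likelihood_ratio//.
by under [X in _ <= X -> _]eq_bigl do rewrite lt_log_likelihood_ratio//.
Qed.

Theorem claim1 (R : realType) :
  ~ JSB [set dist_P0 R]
        [set P : dist R 'I_3 |
          9 / 10 <= expectation P (fun x : 'I_3 => (x : nat)%:R)].
Proof.
move=> [Q0 [Q1 jsb]]; have [/= Q0E] := jsb.
rewrite /expectation big_ord3 /= => mean_ge _.
have Q00 : Q0 o0 = 45 / 100 by rewrite Q0E ffunE.
have Q01 : Q0 o1 = 25 / 100 by rewrite Q0E ffunE.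
have Q02 : Q0 o2 = 30 / 100 by rewrite Q0E ffunE.
have Q0_gt0 x : 0 < Q0 x.
  by rewrite Q0E; case: x => [[|[|[|//]]] ?]; rewrite ffunE /=; lra.
have a0 := pmf_ge0 Q1 o0; have b0 := pmf_ge0 Q1 o1; have c0 := pmf_ge0 Q1 o2.
have := sum_pmf Q1; rewrite big_ord3 => abc.
pose A (s : R) x := s < Q1 x / Q0 x.
(* With competitors as triples of reals and sums as conditionals, each comparison below is linear
   arithmetic after case splits. *)
have bound (s p0 p1 p2 : R) : 0 < s -> 0 <= p0 -> 0 <= p1 -> 0 <= p2 ->
    p0 + p1 + p2 = 1 -> 9 / 10 <= p1 + 2 * p2 ->
    (if A s o0 then Q1 o0 else 0) + (if A s o1 then Q1 o1 else 0)
      + (if A s o2 then Q1 o2 else 0)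
    <= (if A s o0 then p0 else 0) + (if A s o1 then p1 else 0)
      + (if A s o2 then p2 else 0).
  move=> s0 p00 p10 p20 p1E pE.
  have [P [P0E P1E P2E]] := exists_dist3 p00 p10 p20 p1E.
  have CP : 9 / 10 <= expectation P (fun x : 'I_3 => (x : nat)%:R).
    by rewrite /expectation big_ord3 P0E P1E P2E /=; lra.
  have := jsb_superlevel jsb Q0_gt0 CP s0.
  by rewrite big_mkcond [X in _ <= X -> _]big_mkcond !big_ord3 /= P0E P1E P2E.
rewrite /A Q00 Q01 Q02 in bound.
move: (Q1 o0) (Q1 o1) (Q1 o2) => a b c in mean_ge a0 b0 c0 abc bound *.
have L12 : b / (25 / 100) = c / (30 / 100).
  have [lt12|lt21|//] := ltgtP (b / (25 / 100)) (c / (30 / 100)).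
  (* A level midway between the two ratios excludes the point with the smaller one; the point mass
     there gives the superlevel set probability 0, yet [Q1] charges it. *)
  - have := bound ((b / (25 / 100) + c / (30 / 100)) / 2) 0 1 0.
    by do 3?[case: ifPn => ?]; lra.
  - have := bound ((b / (25 / 100) + c / (30 / 100)) / 2) 0 0 1.
    by do 3?[case: ifPn => ?]; lra.
have [lt01|lt10|] := ltgtP (a / (45 / 100)) (b / (25 / 100)); last by lra.
(* Since no value exceeds 2, mean 9/10 forces mass at least 45/100 on {1, 2}; this competitor
   attains that minimum. *)
- have := bound ((a / (45 / 100) + b / (25 / 100)) / 2) (55 / 100) 0 (45 / 100).
  by do 3?[case: ifPn => ?]; lra.
- have := bound ((a / (45 / 100) + b / (25 / 100)) / 2) 0 1 0.
  by do 3?[case: ifPn => ?]; lra.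
Qed.
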